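(* Let $N\in\mathbb{N}$, let $\mathcal{E}$ be a Hilbert space, and let $$K(z,z')=\sum_{w,w'\in\mathcal{F}_N}K_{w,w'}z^w z'^{\,w'^{\top}}\in\mathcal{L}(\mathcal{E})\langle\langle z,z'\rangle\rangle$$ be a formal power series in $2N$ non-commuting indeterminates $z=(z_1,\ldots,z_N)$, $z'=(z'_1,\ldots,z'_N)$. Then $K(z,z')$ is a positive non-commutative kernel if and only if for every $n\in\mathbb{N}$ and every $Z\in\mathrm{Nilp}_N(n)$ the operator $$K(Z,Z)=\sum_{w,w'\in\mathcal{F}_N}K_{w,w'}\otimes Z^w (Z^* )^{w'^{\top}}\in\mathcal{L}(\mathcal{E}\otimes\mathbb{C}^n)$$ (a finite sum) is positive semidefinite, i.e., $\langle K(Z,Z)x,x\rangle_{\mathcal{E}\otimes\mathbb{C}^n}\geq 0$ for any $x\in\mathcal{E}\otimes\mathbb{C}^n$.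
   Context: Hilbert spaces are complex; $\mathcal{L}(\mathcal{E})$ is the algebra of bounded linear operators on $\mathcal{E}$. $\mathcal{F}_N$ is the free semigroup with unit $\emptyset$ (the empty word) on generators $g_1,\ldots,g_N$, with concatenation as multiplication. For $w=g_{j_1}\cdots g_{j_m}\in\mathcal{F}_N$, the transpose is $w^{\top}=g_{j_m}\cdots g_{j_1}$ and the length is $|w|=m$; $\emptyset^{\top}=\emptyset$, $|\emptyset|=0$. Put $z^w=z_{j_1}\cdots z_{j_m}$, $z^{\emptyset}=1$. $\mathcal{L}\langle\langle z_1,\ldots,z_d\rangle\rangle$ is the space of all formal power series in non-commuting indeterminates with coefficients in the vector space $\mathcal{L}$. Positive non-commutative kernel: a series $K(z,z')=\sum_{w,w'\in\mathcal{F}_N}K_{w,w'}z^wz'^{\,w'^{\top}}$ with $K_{w,w'}\in\mathcal{L}(\mathcal{E})$ is a positive non-commutative kernel if for any integer $l$, any words $w^{(1)},\ldots,w^{(l)}\in\mathcal{F}_N$ and any vectors $h^{(1)},\ldots,h^{(l)}\in\mathcal{E}$ one has $\sum_{j,k=1}^l\langle K_{w^{(j)},w^{(k)}}h^{(k)},h^{(j)}\rangle_{\mathcal{E}}\geq 0$. For an $N$-tuple $Z=(Z_1,\ldots,Z_N)\in(\mathbb{C}^{n\times n})^N$ and $w=g_{j_1}\cdots g_{j_m}$, put $Z^w=Z_{j_1}\cdots Z_{j_m}$, $Z^{\emptyset}=I_n$, and $Z^*=(Z_1^*,\ldots,Z_N^* )$. $\mathrm{Nilp}_N(n,r)$ is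 the set of $N$-tuples $Z\in(\mathbb{C}^{n\times n})^N$ such that $Z^w=0$ for all $w\in\mathcal{F}_N$ with $|w|\geq r$ (jointly nilpotent of rank at most $r$), and $\mathrm{Nilp}_N(n)=\bigcup_{r=1}^\infty\mathrm{Nilp}_N(n,r)$. *)

(* Defs.v *)
From HB Require Import structures.
From mathcomp Require Import all_boot all_order all_algebra.
From mathcomp Require Import all_classical all_reals.
From mathcomp Require Import topology normedtype.

Set Implicit Arguments.
Unset Strict Implicit.
Unset Printing Implicit Defensive.
Import Order.TTheory GRing.Theory Num.Theory.
Import numFieldNormedType.Exports.

Local Open Scope classical_set_scope.
Local Open Scope ring_scope.
Local Open Scope sesquilinear_scope.

(* The inner product is linear in its first argument and conjugate-linear in
   its second one. *)
HB.mixin Record CompleteNormedModule_isHilbert (C : numClosedFieldType) E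
    & CompleteNormedModule C E := {
  inner : {dot E for (@Num.conj C)} ;
  sqr_normE : forall x : E, `|x| ^+ 2 = inner x x }.

#[short(type="hilbertType")]
HB.structure Definition Hilbert (C : numClosedFieldType) :=
  {E of CompleteNormedModule C E & CompleteNormedModule_isHilbert C E}.

Section BoundedOperators.
Context {C : numClosedFieldType}.
Variable E : hilbertType C.

Definition is_bounded_linear : {pred E -> E} := fun f =>
  `[< linear f /\ exists M : C, forall x, `|f x| <= M * `|x| >].

Record boundedOp := BoundedOp {
  boundedOp_fun :> E -> E ;
  boundedOpP : boundedOp_fun \in is_bounded_linear }.

HB.instance Definition _ := [isSub for boundedOp_fun].
HB.instance Definition _ := [Choice of boundedOp by <:].

Lemma bounded_linear_submod : submod_closed is_bounded_linear.
Proof.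
split.
  apply/asboolP; split; first by move=> a x y; rewrite /= scaler0 addr0.
  by exists 0 => x; rewrite normr0 mul0r.
move=> a f g /asboolP[lf [Mf bf]] /asboolP[lg [Mg bg]].
apply/asboolP; split=> [b x y|].
  rewrite !fctE lf lg scalerDr !scalerDr !scalerA mulrC -!addrA; congr (_ + _).
  by rewrite addrCA.
exists (`|a| * Mf + Mg) => x; rewrite !fctE (le_trans (ler_normD _ _))//.
by rewrite mulrDl lerD// normrZ -mulrA ler_wpM2l.
Qed.

HB.instance Definition _ :=
  GRing.isSubmodClosed.Build _ _ is_bounded_linear bounded_linear_submod.
HB.instance Definition _ := [SubChoice_isSubLmodule of boundedOp by <:].

Definition positive_op (T : boundedOp) := forall x : E, 0 <= inner (T x) x.

End BoundedOperators.

(* E (x) C^n, as the n-fold Hilbert direct sum of E: x stands for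
   \sum_i x i (x) e_i, with e_i the standard basis of C^n (see inner_tensv and
   tensv_decomp). *)
Definition tensorC (C : numClosedFieldType) (E : hilbertType C) (n : nat) :=
  {ffun 'I_n -> E}.

Section TensorC.
Context {C : numClosedFieldType}.
Variables (E : hilbertType C) (n : nat).
Local Notation En := (tensorC E n).

HB.instance Definition _ := GRing.Lmodule.on En.

Definition tensorC_norm (x : En) : C := sqrtC (\sum_i `|x i| ^+ 2).

Lemma tensorC_normE (x : En) :
  tensorC_norm x ^+ 2 = \sum_i `|x i| ^+ 2.
Proof. by rewrite sqrtCK. Qed.

Lemma tensorC_norm_ge0 (x : En) : 0 <= tensorC_norm x.
Proof. by rewrite sqrtC_ge0 sumr_ge0// => i _; rewrite exprn_ge0. Qed.

Lemma le_tensorC_norm (x : En) i : `|x i| <= tensorC_norm x.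
Proof.
rewrite -ler_sqr ?nnegrE ?tensorC_norm_ge0// tensorC_normE (bigD1 i)//=.
by rewrite lerDl sumr_ge0// => j _; rewrite exprn_ge0.
Qed.

Lemma tensorC_norm_dotmx (x : En) :
  tensorC_norm x = sqrtC (dotmx (\row_i `|x i|) (\row_i `|x i|)).
Proof.
rewrite dotmxE mxE; congr (sqrtC _); apply: eq_bigr => i _.
by rewrite !mxE conj_Creal ?normr_real// expr2.
Qed.

Lemma tensorC_normD (x y : En) :
  tensorC_norm (x + y) <= tensorC_norm x + tensorC_norm y.
Proof.
have := (triangle_lerif (@dotmx C n) (\row_i `|x i|) (\row_i `|y i|)).1.
rewrite -!tensorC_norm_dotmx => /(le_trans _); apply.
rewrite ler_sqrtC ?nnegrE ?dnorm_ge0//; last first.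
  by rewrite sumr_ge0// => i _; rewrite exprn_ge0.
rewrite [leRHS]dotmxE mxE; apply: ler_sum => i _.
rewrite !mxE conj_Creal ?rpredD ?normr_real// -expr2.
by rewrite lerXn2r ?nnegrE ?addr_ge0// ffunE ler_normD.
Qed.

Lemma tensorC_normZ (a : C) (x : En) :
  tensorC_norm (a *: x) = `|a| * tensorC_norm x.
Proof.
rewrite /tensorC_norm (eq_bigr (fun i => `|a| ^+ 2 * `|x i| ^+ 2)); last first.
  by move=> i _; rewrite ffunE normrZ exprMn.
rewrite -mulr_sumr rootCMl ?exprn_ge0//; congr (_ * _).
by rewrite sqrCK.
Qed.

Lemma tensorC_norm_eq0 (x : En) : tensorC_norm x = 0 -> x = 0.
Proof.
move=> x0; apply/ffunP => i; rewrite ffunE; apply/eqP.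
by rewrite -normr_le0 -x0 le_tensorC_norm.
Qed.

HB.instance Definition _ := Lmodule_isNormed.Build C En
  tensorC_normD tensorC_normZ tensorC_norm_eq0.

Lemma tensorC_sqr_normE (x : En) : `|x| ^+ 2 = \sum_i `|x i| ^+ 2.
Proof. exact: tensorC_normE. Qed.

Lemma tensorC_complete (F : set_system En) :
  ProperFilter F -> cauchy F -> cvg F.
Proof.
move=> FF /cauchyP Fc.
have Fi (i : 'I_n) : cvg ((fun x : En => x i) @ F).
  apply: cauchy_cvg; apply/cauchyP => e e0.
  have [x Fx] := Fc _ e0; exists (x i).
  apply: (@filterS _ F _ (ball x e)) Fx => y.
  rewrite -!ball_normE /=; apply: le_lt_trans.
  by have := le_tensorC_norm (x - y) i; rewrite !ffunE.
pose l : En := [ffun i => lim ((fun x : En => x i) @ F)].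
apply/cvg_ex; exists l; apply/cvgrPdist_lt => e e0.
have n0 : 0 < (n.+1)%:R :> C by rewrite ltr0n.
have d0 : 0 < e / n.+1%:R by rewrite divr_gt0.
have : F [set x : En | forall i : 'I_n, `|l i - x i| < e / n.+1%:R].
  apply: filter_forall => i; move: (Fi i) => /cvgrPdist_lt/(_ _ d0).
  by apply: filterS => x; rewrite ffunE.
apply: filterS => x lx.
rewrite -ltr_sqr ?nnegrE ?(ltW e0)// tensorC_sqr_normE.
apply: (@le_lt_trans _ _ (\sum_(i < n) (e / n.+1%:R) ^+ 2)).
  apply: ler_sum => i _; rewrite lerXn2r ?nnegrE ?(ltW d0)// ltW//.
  by have := lx i; rewrite !ffunE.
rewrite sumr_const card_ord exprMn -mulrnAr gtr_pMr ?exprn_gt0//.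
rewrite exprVn -mulr_natl ltr_pdivrMr ?exprn_gt0// mul1r -natrX ltr_nat.
by rewrite (@leq_trans n.+1)// expnS leq_pmulr.
Qed.

HB.instance Definition _ := Uniform_isComplete.Build En tensorC_complete.

Definition tensorC_inner (x y : En) : C := \sum_i inner (x i) (y i).

Lemma tensorC_inner_bilinear :
  bilinear_for *%R (@Num.conj C \; *%R) tensorC_inner.
Proof.
split=> [y a u v|x a u v]; rewrite /tensorC_inner /= mulr_sumr -big_split /=.
  by apply: eq_bigr => i _; rewrite !ffunE linearPl.
by apply: eq_bigr => i _; rewrite !ffunE linearPr.
Qed.

HB.instance Definition _ :=
  bilinear_isBilinear.Build C En En C *%R (@Num.conj C \; *%R) tensorC_inner
   tensorC_inner_bilinear.

Lemma tensorC_inner_herm (x y : En) :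
  tensorC_inner x y = (-1) ^+ false * (tensorC_inner y x)^*.
Proof.
rewrite mul1r rmorph_sum; apply: eq_bigr => i _.
by rewrite /= hermC mul1r.
Qed.

HB.instance Definition _ :=
  isHermitianSesquilinear.Build C En false (@Num.conj C) tensorC_inner
    tensorC_inner_herm.

Lemma tensorC_sqr_norm (x : En) : `|x| ^+ 2 = tensorC_inner x x.
Proof.
by rewrite tensorC_sqr_normE; apply: eq_bigr => i _; rewrite sqr_normE.
Qed.

Lemma tensorC_inner_gt0 (x : En) : x != 0 -> 0 < tensorC_inner x x.
Proof. by move=> x0; rewrite -tensorC_sqr_norm exprn_gt0// normr_gt0. Qed.

HB.instance Definition _ :=
  isDotProduct.Build C En tensorC_inner tensorC_inner_gt0.

HB.instance Definition _ :=
  CompleteNormedModule_isHilbert.Build C En tensorC_sqr_norm.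

(* h (x) u *)
Definition tensv (h : E) (u : 'cV[C]_n) : En := [ffun i => u i 0 *: h].

Lemma inner_tensv h h' u u' :
  inner (tensv h u) (tensv h' u') = inner h h' * \sum_i u i 0 * (u' i 0)^*.
Proof.
rewrite mulr_sumr; apply: eq_bigr => i _.
by rewrite !ffunE linearZl_LR linearZr_LR /= mulrA mulrC.
Qed.

Lemma tensv_decomp (x : En) : x = \sum_i tensv (x i) (delta_mx i 0).
Proof.
apply/ffunP => i; rewrite sum_ffunE (bigD1 i)//= big1 ?addr0 => [|j ji].
  by rewrite ffunE mxE !eqxx scale1r.
by rewrite ffunE mxE eq_sym (negbTE ji) scale0r.
Qed.

Lemma tensv_norm h u : `|tensv h u| = `|h| * sqrtC (\sum_i `|u i 0| ^+ 2).
Proof.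
apply/eqP; rewrite -(@eqrXn2 _ 2)// ?mulr_ge0 ?sqrtC_ge0 ?sumr_ge0//; last first.
  by move=> i _; rewrite exprn_ge0.
rewrite tensorC_sqr_normE exprMn sqrtCK mulr_sumr; apply/eqP.
by apply: eq_bigr => i _; rewrite ffunE normrZ exprMn mulrC.
Qed.

Definition tens_fun (A : boundedOp E) (M : 'M[C]_n) (x : En) : En :=
  [ffun i => \sum_j M i j *: A (x j)].

Lemma tens_fun_bounded A M : tens_fun A M \in @is_bounded_linear C En.
Proof.
have /asboolP[linA [c cA]] := boundedOpP A; apply/asboolP; split.
  move=> a x y; apply/ffunP => i; rewrite !ffunE scaler_sumr -big_split /=.
  by apply: eq_bigr => j _; rewrite !ffunE linA scalerDr !scalerA mulrC.
exists (\sum_i \sum_j `|M i j| * `|c|) => x.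
rewrite [tens_fun A M x]tensv_decomp.
rewrite (le_trans (ler_norm_sum _ _ _))// mulr_suml ler_sum// => i _.
rewrite tensv_norm (_ : sqrtC _ = 1) ?mulr1; last first.
  rewrite (bigD1 i)//= big1 ?addr0 => [|j /negbTE ji].
    by rewrite mxE !eqxx normr1 expr1n sqrtC1.
  by rewrite mxE ji normr0 expr0n.
rewrite ffunE (le_trans (ler_norm_sum _ _ _))// mulr_suml ler_sum// => j _.
rewrite normrZ -mulrA ler_wpM2l// (le_trans (cA _))//.
apply: (@le_trans _ _ (`|c| * `|x j|)); last first.
  by rewrite ler_wpM2l// le_tensorC_norm.
rewrite -[leLHS]ger0_norm ?normrM ?normr_id//.
exact: le_trans (cA _).
Qed.

(* A (x) M, which tens_op_tensv and tensv_decomp characterize. *)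
Definition tens_op A M : boundedOp En := BoundedOp (tens_fun_bounded A M).

Lemma tens_op_tensv A M h u : tens_op A M (tensv h u) = tensv (A h) (M *m u).
Proof.
have /asboolP[linA _] := boundedOpP A.
pose f := GRing.isLinear.Build _ _ _ _ (A : E -> E) linA.
pose lA : {linear E -> E} := HB.pack (A : E -> E) f.
apply/ffunP => i; rewrite !ffunE mxE scaler_suml; apply: eq_bigr => j _.
by rewrite !ffunE -[A _]/(lA _) linearZ scalerA.
Qed.

End TensorC.

Notation word N := (seq 'I_N).

(* A formal power series in non-commuting indeterminates indexed by I is its
   family of coefficients; the word v stands for the monomial z^v. *)
Definition ncseries (I L : Type) := seq I -> L.

Section MatrixTuples.
Context {C : numClosedFieldType}.
Variables N n : nat.

Definition mxword (Z : 'I_N -> 'M[C]_n) (w : word N) : 'M[C]_n :=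
  \prod_(j <- w) Z j.

Definition Nilp_rank r : set ('I_N -> 'M[C]_n) :=
  [set Z | forall w : word N, (r <= size w)%N -> mxword Z w = 0].

Definition Nilp : set ('I_N -> 'M[C]_n) :=
  \bigcup_(r in [set r | (0 < r)%N]) Nilp_rank r.

Lemma mxword_adjoint (Z : 'I_N -> 'M[C]_n) w :
  mxword (fun j => (Z j)^t*) (rev w) = (mxword Z w)^t*.
Proof.
rewrite /mxword; elim: w => [|j w IHw].
  by rewrite !big_nil -[1]/(1%:M) trmx1 map_mx1.
rewrite rev_cons -cats1 big_cat big_seq1 IHw big_cons /=.
by rewrite -[in RHS]mulmxE trmx_mul map_mxM.
Qed.

End MatrixTuples.

Arguments Nilp_rank {C} N n r _.
Arguments Nilp {C} N n _.

Section Kernels.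
Context {C : numClosedFieldType}.
Variables (N : nat) (E : hilbertType C).

(* The monomial z^w z'^(w'^T), with z_j indexed by inl j and z'_j by inr j. *)
Definition kernel_monomial (w w' : word N) : seq ('I_N + 'I_N) :=
  map inl w ++ map inr (rev w').

Implicit Types K : ncseries ('I_N + 'I_N) (boundedOp E).

Definition kernel_form K :=
  forall v, (forall w w', v <> kernel_monomial w w') -> K v = 0.

Definition kernel_coef K (w w' : word N) := K (kernel_monomial w w').

Definition positive_nc_kernel K :=
  forall (l : nat) (w : 'I_l -> word N) (h : 'I_l -> E),
    0 <= \sum_(j < l) \sum_(k < l)
      inner (kernel_coef K (w j) (w k) (h k)) (h j).

Definition kernel_term K n (Z : 'I_N -> 'M[C]_n) (p : word N * word N) :
    boundedOp (tensorC E n) :=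
  tens_op (kernel_coef K p.1 p.2)
    (mxword Z p.1 *m mxword (fun j => (Z j)^t*) (rev p.2)).

(* K(Z, Z); the sum is finite on Nilp, see kernel_term_finite. *)
Definition kernel_eval K n (Z : 'I_N -> 'M[C]_n) : boundedOp (tensorC E n) :=
  \sum_(p \in [set: word N * word N]) kernel_term K Z p.

Lemma kernel_term_finite K n (Z : 'I_N -> 'M[C]_n) : Nilp N n Z ->
  finite_set [set p | kernel_term K Z p != 0].
Proof.
case=> r _ Zr.
pose short : seq (word N) := [seq val t | s <- iota 0 r, t <- enum {: s.-tuple 'I_N}].
have inS w : (size w < r)%N -> w \in short.
  move=> wr; apply/allpairsPdep; exists (size w), (in_tuple w).
  by rewrite mem_iota mem_enum.
apply: (@sub_finite_set _ _ [set` [seq (w, w') | w <- short, w' <- short]]).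
  move=> [w w'] /= nz.
  apply/allpairsP; exists (w, w'); split=> //=; apply: inS; rewrite ltnNge;
    apply: contra_neqN nz => rw; apply/val_inj/funext => x; apply/ffunP => i;
    rewrite !ffunE big1// => j _; rewrite ?mxword_adjoint (Zr _ rw).
    by rewrite mul0mx mxE scale0r.
  by rewrite trmx0 map_mx0 mulmx0 mxE scale0r.
exact: finite_seq.
Qed.

End Kernels.

(* Main.v *)
Require Import Defs.
From HB Require Import structures.
From mathcomp Require Import all_boot all_order all_algebra.
From mathcomp Require Import complex ring.
From mathcomp Require Import all_classical all_reals.
From mathcomp Require Import topology normedtype.

(** Everything rests on one identity.  If Z is jointly nilpotent and all its
    words longer than m vanish, expanding the entries of Z^w (Z^v)^* as sums
    over a of Z^w_(i,a) conj(Z^v_(j,a)) gives [kernel_eval_gram]: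
      <K(Z,Z) x, x> = \sum_a \sum_(u,v) <K_(u,v) h_a(v), h_a(u)>,
    where h_a(w) = \sum_i conj(Z^w_(i,a)) x_i.  Each inner sum, called
    [word_gram] below, is one of the sums in the definition of a positive
    kernel, so positivity of K gives positivity of K(Z,Z).

    For the converse, the sum attached to finitely many words and vectors is
    also a Gram sum of some y : word N -> E vanishing on long words
    ([word_gram_family]), so it is enough to find Z and x for which h_a = y for
    one column a and the other columns are negligible.  Take for Z the creation
    operators e_v |-> e_(j v) on the span of the words of length at most m,
    conjugated by the diagonal matrix of weights c(v) ([wshift]).  With
    x_v = conj(c(v))^-1 y(v) one gets h_a(w) = conj(c(a))^-1 y(w a)
    ([wshift_coords]).  With c = 1 at the empty word and c = 1/t elsewhere,
    the empty word contributes the Gram sum of y, and all other columns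
    together contribute t^2 times a constant independent of t.  The sum is
    nonnegative for every t > 0; letting t tend to 0
    ([ge0_of_perturbation]) shows that the Gram sum of y is nonnegative. *)

Set Implicit Arguments.
Unset Strict Implicit.
Unset Printing Implicit Defensive.
Local Open Scope ring_scope.

Import Order.TTheory GRing.Theory Num.Theory.
Local Open Scope sesquilinear_scope.

(** * Bounded operators as linear maps *)

Section BoundedOpLinear.
Context {C : numClosedFieldType} {E : hilbertType C}.

Lemma boundedOp_linear (A : boundedOp E) : linear (A : E -> E).
Proof. by have /asboolP[] := boundedOpP A. Qed.

HB.instance Definition _ (A : boundedOp E) :=
  GRing.isLinear.Build C E E _ (boundedOp_fun A) (boundedOp_linear A).

Lemma boundedOpZ (A : boundedOp E) a x : A (a *: x) = a *: A x.
Proof. exact: linearZ. Qed.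

Lemma boundedOp_sum (A : boundedOp E) I (r : seq I) (P : pred I) (F : I -> E) :
  A (\sum_(i <- r | P i) F i) = \sum_(i <- r | P i) A (F i).
Proof. exact: linear_sum. Qed.

Lemma boundedOp_sumE I (r : seq I) (T : I -> boundedOp E) (x : E) :
  (\sum_(i <- r) T i) x = \sum_(i <- r) T i x.
Proof. by elim/big_rec2: _ => // i y A _ <-. Qed.

Lemma inner_boundedOp_comb (A : boundedOp E) n (b c : 'I_n -> C)
    (x : 'I_n -> E) :
  inner (A (\sum_j (b j)^* *: x j)) (\sum_i (c i)^* *: x i) =
  \sum_i \sum_j c i * (b j)^* * inner (A (x j)) (x i).
Proof.
rewrite linear_sumr; apply: eq_bigr => i _.
rewrite boundedOp_sum linear_sumlz; apply: eq_bigr => j _.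
by rewrite boundedOpZ linearZr_LR linearZl_LR /= conjCK mulrA.
Qed.

End BoundedOpLinear.

(** * Gram sums of a kernel over words of bounded length *)

Section WordGram.
Context {C : numClosedFieldType} {N : nat} {E : hilbertType C}.
Variable K : ncseries ('I_N + 'I_N) (boundedOp E).

(** The family y is indexed by all words, although only those of length at most
    m enter the sum, so that it can be translated to w |-> y (w ++ a). *)
Definition word_gram m (y : word N -> E) : C :=
  \sum_(u : m.-bseq 'I_N) \sum_(v : m.-bseq 'I_N)
    inner (kernel_coef K u v (y v)) (y u).

Lemma eq_word_gram m (y y' : word N -> E) : y =1 y' ->
  word_gram m y = word_gram m y'.
Proof.
by move=> yy'; apply: eq_bigr => u _; apply: eq_bigr => v _; rewrite !yy'.
Qed.

Lemma word_gramZ m (c : C) (y : word N -> E) :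
  word_gram m (fun w => c *: y w) = `|c| ^+ 2 * word_gram m y.
Proof.
rewrite mulr_sumr; apply: eq_bigr => u _; rewrite mulr_sumr.
apply: eq_bigr => v _.
by rewrite boundedOpZ linearZl_LR linearZr_LR /= mulrA normCK.
Qed.

Lemma word_gram_ge0 m y : positive_nc_kernel K -> 0 <= word_gram m y.
Proof.
move=> Kpos; rewrite /word_gram big_enum_val /=.
under eq_bigr do rewrite big_enum_val /=.
exact: (Kpos _ (fun i => bseqval (enum_val i)) (fun i => y (enum_val i))).
Qed.

(** The words w j need not be distinct: the vectors attached to the same word
    are added up, as the summands depend on j and k sesquilinearly through
    h j and h k once the words are fixed. *)
Lemma word_gram_family m l (w : 'I_l -> word N) (h : 'I_l -> E) :
  (forall j, (size (w j) <= m)%N) ->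
  \sum_(j < l) \sum_(k < l) inner (kernel_coef K (w j) (w k) (h k)) (h j)
  = word_gram m (fun u => \sum_(j < l | w j == u) h j).
Proof.
move=> wm; pose W j : m.-bseq 'I_N := Bseq (wm j).
rewrite (partition_big W predT) //=; apply: eq_bigr => u _.
under eq_bigr do rewrite (partition_big W predT) //=.
rewrite exchange_big /=; apply: eq_bigr => v _.
rewrite boundedOp_sum linear_sumlz exchange_big /=.
apply: eq_bigr => k /eqP <-; rewrite linear_sumr.
by apply: eq_bigr => j /eqP <-.
Qed.

Lemma kernel_eval_short n m (Z : 'I_N -> 'M[C]_n) : Nilp_rank N n m.+1 Z ->
  kernel_eval K Z =
  \sum_(u : m.-bseq 'I_N) \sum_(v : m.-bseq 'I_N)
    kernel_term K Z (bseqval u, bseqval v).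
Proof.
move=> Zm; rewrite pair_big /=.
pose f (q : m.-bseq 'I_N * m.-bseq 'I_N) : word N * word N :=
  (bseqval q.1, bseqval q.2).
have f_inj : injective f by move=> [a b] [c d] [/val_inj-> /val_inj->].
rewrite /kernel_eval (fsbigE [seq f q | q <- index_enum _]); first last.
- move=> [w w'] _ nf; apply/val_inj/funext => x; apply/ffunP => i.
  (* Z^w or Z^w' vanishes as soon as one of the words is longer than m *)
  have [sw|sw] := ltnP m (size w).
    by rewrite !ffunE big1// => j _; rewrite /= (Zm _ sw) mul0mx mxE scale0r.
  have [sw'|sw'] := ltnP m (size w').
    rewrite !ffunE big1// => j _; rewrite mxword_adjoint (Zm _ sw').
    by rewrite trmx0 map_mx0 mulmx0 mxE scale0r.
  case/negP: nf; apply/mapP; exists (Bseq sw, Bseq sw') => //.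
  by rewrite mem_index_enum.
- by [].
- by rewrite map_inj_uniq ?index_enum_uniq.
rewrite big_map; apply: eq_big => [q|q _]; last by [].
by rewrite in_setT.
Qed.

(** The product Z^u (Z^v)^* is expanded over its middle index a; by
    sesquilinearity the entry of Z^u then moves into the second argument of
    the inner product and that of (Z^v)^* into the first. *)
Lemma kernel_eval_gram n m (Z : 'I_N -> 'M[C]_n) (x : tensorC E n) :
  Nilp_rank N n m.+1 Z ->
  inner (kernel_eval K Z x) x =
  \sum_a word_gram m (fun w => \sum_i (mxword Z w i a)^* *: x i).
Proof.
move=> Zm; rewrite (kernel_eval_short Zm) exchange_big boundedOp_sumE.
rewrite linear_sumlz [RHS]exchange_big [RHS]/=.
under [RHS]eq_bigr do rewrite exchange_big.
rewrite [RHS]exchange_big /=.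
apply: eq_bigr => v _; rewrite boundedOp_sumE linear_sumlz.
apply: eq_bigr => u _.
rewrite -[LHS]/(\sum_i inner (kernel_term K Z (bseqval u, bseqval v) x i) (x i)).
under [RHS]eq_bigr do rewrite inner_boundedOp_comb.
rewrite [RHS]exchange_big; apply: eq_bigr => i _.
rewrite [RHS]exchange_big ffunE linear_sumlz; apply: eq_bigr => j _.
rewrite linearZl_LR /= mxword_adjoint mxE mulr_suml; apply: eq_bigr => a _.
by rewrite !mxE.
Qed.

End WordGram.

(** * Weighted creation operators *)

Section WeightedShift.
Context {C : numClosedFieldType} {N : nat}.
Variables (m : nat) (c : word N -> C).
Hypothesis c_neq0 : forall w, c w != 0.

Local Notation W := (m.-bseq 'I_N).
Local Notation lab := (fun p : 'I_#|{: W}| => bseqval (enum_val p)).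

(** The compression to words of length at most m of the creation operator
    e_v |-> e_(j v), conjugated by the diagonal matrix of the weights c.  Since
    the conjugation commutes with products, the weights along a word telescope
    in [mxword_wshift]. *)
Definition wshift (j : 'I_N) : 'M[C]_#|{: W}| :=
  \matrix_(p, q) ((lab p == j :: lab q)%:R * (c (lab p) / c (lab q))).

(** Truncation does not break multiplicativity: prepending letters to a word
    which is too long leaves it too long. *)
Lemma mxword_wshift w p q :
  mxword wshift w p q =
  (lab p == w ++ lab q)%:R * (c (lab p) / c (lab q)).
Proof.
elim: w p => [|j w IHw] p.
  rewrite /mxword big_nil mxE /= val_eqE (inj_eq enum_val_inj).
  by case: eqVneq => [->|_]; rewrite ?mulr0n ?mul0r// divff ?mulr1.
rewrite /mxword big_cons -/(mxword wshift w) mxE /=.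
have [sw|sw] := leqP (size (w ++ lab q)) m; last first.
  (* w ++ lab q is too long to be a basis word, and so is j :: w ++ lab q *)
  rewrite [in RHS](_ : _ == _ = false) ?mul0r; last first.
    apply/eqP => pq; have := size_bseq (enum_val p).
    by rewrite pq /= leqNgt ltnS (ltnW sw).
  rewrite big1// => r _; rewrite IHw (_ : _ == _ = false) ?mul0r ?mulr0//.
  apply/eqP => rq; have := size_bseq (enum_val r).
  by rewrite rq leqNgt sw.
pose r0 := enum_rank (Bseq sw : W).
have r0E : lab r0 = w ++ lab q by rewrite /r0 enum_rankK.
rewrite (bigD1 r0)//= big1 ?addr0 => [|r rr0]; last first.
  rewrite IHw -r0E (_ : _ == _ = false) ?mul0r ?mulr0//.
  by rewrite val_eqE (inj_eq enum_val_inj) (negbTE rr0).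
rewrite IHw mxE r0E eqxx mul1r -mulrA; congr (_ * _).
by rewrite -mulrA mulKf.
Qed.

Lemma wshift_nilp : Nilp_rank N _ m.+1 wshift.
Proof.
move=> w mw; apply/matrixP => p q; rewrite mxword_wshift mxE.
rewrite (_ : _ == _ = false) ?mul0r//; apply/eqP => pq.
have := size_bseq (enum_val p); rewrite pq size_cat leqNgt.
by rewrite ltn_addr.
Qed.

(** Scaling the coordinates of x by the inverse conjugate weights cancels the
    weight of the row, so that only the weight of the column q survives.  This
    makes it possible to damp all columns except that of the empty word. *)
Lemma wshift_coords (E : lmodType C) (y : word N -> E) w q :
  (forall u, (m < size u)%N -> y u = 0) ->
  \sum_p (mxword wshift w p q)^* *: (((c (lab p))^*)^-1 *: y (lab p))
  = ((c (lab q))^*)^-1 *: y (w ++ lab q).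
Proof.
move=> y0.
have [sw|sw] := leqP (size (w ++ lab q)) m; last first.
  rewrite y0// scaler0 big1// => p _; rewrite mxword_wshift.
  rewrite (_ : _ == _ = false) ?mul0r ?conjC0 ?scale0r//; apply/eqP => pq.
  by have := size_bseq (enum_val p); rewrite pq leqNgt sw.
pose r0 := enum_rank (Bseq sw : W).
have r0E : lab r0 = w ++ lab q by rewrite /r0 enum_rankK.
rewrite (bigD1 r0)//= big1 ?addr0 => [|r rr0]; last first.
  rewrite mxword_wshift -r0E (_ : _ == _ = false) ?mul0r ?conjC0 ?scale0r//.
  by rewrite val_eqE (inj_eq enum_val_inj) (negbTE rr0).
rewrite mxword_wshift r0E eqxx mul1r rmorphM fmorphV scalerA; congr (_ *: _).
by rewrite mulrAC divff ?mul1r// conjC_eq0.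
Qed.

End WeightedShift.

(** * Letting the weight tend to zero *)

(** The order of C is only partial, as for the complex numbers, and
    0 <= A includes that A is real; the values t = 1 and t = 2 already give
    that. *)
Lemma ge0_of_perturbation (C : numFieldType) (A B : C) :
  (forall t : C, 0 < t -> 0 <= A + t ^+ 2 * B) -> 0 <= A.
Proof.
move=> AB.
have BR : B \is Num.real.
  have -> : B = ((A + 2 ^+ 2 * B) - (A + 1 ^+ 2 * B)) / 3.
    by field.
  by rewrite rpredM ?rpredB ?rpredV ?realn ?ger0_real ?AB.
have AR : A \is Num.real.
  have -> : A = (A + 1 ^+ 2 * B) - B by rewrite expr1n mul1r addrK.
  by rewrite rpredB// ger0_real// AB.
have [//|A0] := real_ge0P AR.
have B0 : 0 < B.
  have := AB 1 ltr01; rewrite expr1n mul1r -lerBlDl sub0r.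
  by apply: lt_le_trans; rewrite oppr_gt0.
have D0 : 0 < B - A by rewrite subr_gt0 (lt_trans A0).
(* t < 1 and t * B < - A, hence t ^+ 2 * B < - A *)
pose t := - A / (B - A).
have t0 : 0 < t by rewrite divr_gt0 ?oppr_gt0.
have t1 : t < 1 by rewrite ltr_pdivrMr// mul1r ltrDr.
suff Alt0 : A + t ^+ 2 * B < 0 by have := AB t t0; rewrite lt_geF.
rewrite -ltrBrDl sub0r (@lt_trans _ _ (t * B))//.
  by rewrite ltr_pM2r// expr2 gtr_pMl.
by rewrite mulrAC ltr_pdivrMr// ltr_pM2l ?oppr_gt0// ltrDl oppr_gt0.
Qed.

Theorem theorem3 (R : realType) (N : nat) (E : hilbertType R[i])
    (K : ncseries ('I_N + 'I_N) (boundedOp E)) (hK : kernel_form K) :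
  positive_nc_kernel K <->
  (forall (n : nat) (Z : 'I_N -> 'M[R[i]]_n),
     Nilp N n Z -> positive_op (kernel_eval K Z)).
Proof.
split=> [Kpos n Z [[//|m] _ Zm] x|Kev l w h].
  rewrite (kernel_eval_gram _ _ Zm); apply: sumr_ge0 => a _.
  exact: word_gram_ge0.
pose m := \max_j size (w j).
have wm j : (size (w j) <= m)%N by exact: leq_bigmax.
rewrite (word_gram_family K h wm).
set y := fun u => _.
have y0 u : (m < size u)%N -> y u = 0.
  move=> mu; apply: big_pred0 => j; apply: contraTF mu => /eqP <-.
  by rewrite -leqNgt.
(* the column of the empty word *)
pose e := enum_rank ([bseq] : m.-bseq 'I_N).
have lab_e q : (bseqval (enum_val q) == [::]) = (q == e).
  rewrite -[[::]]/(bseqval ([bseq] : m.-bseq 'I_N)) val_eqE.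
  by rewrite -(inj_eq enum_val_inj) enum_rankK.
apply: (@ge0_of_perturbation _ _ (\sum_(q | q != e)
   word_gram K m (fun w => y (w ++ bseqval (enum_val q))))) => t t0.
pose c (u : word N) : R[i] := if u == [::] then 1 else t^-1.
have c0 u : c u != 0.
  by rewrite /c; case: ifP => _; rewrite ?oner_neq0 ?invr_neq0 ?gt_eqF.
have cR u : (c u)^* = c u.
  rewrite /c; case: ifP => _; rewrite ?conjC1// geC0_conj// invr_ge0 ltW//.
pose x : tensorC E #|{: m.-bseq 'I_N}| :=
  [ffun p => ((c (bseqval (enum_val p)))^*)^-1 *: y (bseqval (enum_val p))].
have Zm := wshift_nilp (m := m) c0.
have ZN : Nilp N _ (wshift m c) by exists m.+1.
have := Kev _ _ ZN x.
rewrite (kernel_eval_gram _ _ Zm) (eq_bigr (fun q =>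
  `|(c (bseqval (enum_val q)))^-1| ^+ 2 *
    word_gram K m (fun w => y (w ++ bseqval (enum_val q))))); last first.
  move=> q _; rewrite -word_gramZ; apply: eq_word_gram => u.
  under eq_bigr do rewrite ffunE.
  by rewrite wshift_coords// cR.
rewrite (bigD1 e)//= {1 2}enum_rankK /c eqxx invr1 normr1 expr1n mul1r.
rewrite (eq_word_gram _ _ (y' := y)); last by move=> u; rewrite cats0.
rewrite mulr_sumr; congr (0 <= _ + _); apply: eq_bigr => q qe.
by rewrite lab_e (negbTE qe) invrK gtr0_norm.
Qed.
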